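(* Let $\{a_{\ell,m},b_{\ell,m}:\ \ell=1,2,\dots,\ m=-\ell,\dots,\ell\}$ be two complex sequences and let $L\ge1$. With the vector spherical harmonics $\mathbf{y}_{\ell,m},\mathbf{z}_{\ell,m}$, the scalar partial sums $S_{K}(\cdot)$ and the coefficients $\nu^{(i)}_{\ell,m}$ ($i=1,\dots,6$), $\eta^{(j)}_{\ell,m}$ ($j=1,2,3$) defined in the context, the adjoint vector spherical harmonic transform $$\mathbf{S}_L(a_{\ell,m},b_{\ell,m}):=\sum_{\ell=1}^{L}\sum_{m=-\ell}^{\ell}\bigl(a_{\ell,m}\mathbf{y}_{\ell,m}+b_{\ell,m}\mathbf{z}_{\ell,m}\bigr)$$ can be represented by adjoint scalar spherical harmonic transforms as follows, as an identity of functions on $\mathbb{S}^2$: $$\mathbf{S}_L(a_{\ell,m},b_{\ell,m})=\begin{pmatrix} -\frac{1}{\sqrt2}\Bigl(S_{L-1}\bigl(\nu^{(1)}_{\ell,m}\bigr)+S_{L+1}\bigl(\nu^{(2)}_{\ell,m}\bigr)+S_{L}\bigl(\eta^{(1)}_{\ell,m}\bigr)\Bigr)\\[2mm] -\frac{1}{\sqrt2}\Bigl(S_{L-1}\bigl(\nu^{(3)}_{\ell,m}\bigr)+S_{L+1}\bigl(\nu^{(4)}_{\ell,m}\bigr)-S_{L}\bigl(\eta^{(2)}_{\ell,m}\bigr)\Bigr)\\[2mm] S_{L-1}\bigl(\nu^{(5)}_{\ell,m}\bigr)+S_{L+1}\bigl(\nu^{(6)}_{\ell,m}\bigr)+S_{L}\bigl(\eta^{(3)}_{\ell,m}\bigr)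 \end{pmatrix}.$$
   Context: $\mathbb{S}^2$ is the unit sphere of $\mathbb{R}^3$; $\mathrm{i}$ is the imaginary unit; $^*$ denotes complex conjugation of scalars. Scalar spherical harmonics. In spherical coordinates $\mathbf{x}=(\sin\theta\cos\varphi,\sin\theta\sin\varphi,\cos\theta)'$ (with $'$ the transpose), for $\ell=0,1,\dots$, $Y_{\ell,m}(\mathbf{x})=\sqrt{\frac{2\ell+1}{4\pi}\frac{(\ell-m)!}{(\ell+m)!}}\,P_\ell^{m}(\cos\theta)e^{\mathrm{i}m\varphi}$ for $m=0,\dots,\ell$, and $Y_{\ell,m}=(-1)^m\,Y_{\ell,-m}^{*}$ for $m=-\ell,\dots,-1$, where $P_\ell^m(t)=\frac{(-1)^m}{2^\ell\ell!}(1-t^2)^{m/2}\frac{d^{\ell+m}}{dt^{\ell+m}}(t^2-1)^\ell$ is the associated Legendre function. Convention: $Y_{\ell,m}=0$ if $|m|>\ell$. Clebsch–Gordan coefficients. $C^{\ell,m}_{j_1,m_1,j_2,m_2}=(-1)^{m+j_1-j_2}\sqrt{2\ell+1}\begin{pmatrix}j_1&j_2&\ell\\ m_1&m_2&-m\end{pmatrix}$ (Wigner $3$-$j$ symbol). Those needed are, for $\ell\ge1$ and $-\ell\le m\le \ell$, $$\begin{aligned} &C^{\ell,m}_{\ell-1,m-1,1,1}=\sqrt{\tfrac{(\ell+m)(\ell+m-1)}{(2\ell)(2\ell-1)}}, && C^{\ell,m}_{\ell+1,m-1,1,1}=\sqrt{\tfrac{(\ell-m+1)(\ell-m+2)}{(2\ell+2)(2\ell+3)}},\\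 &C^{\ell,m}_{\ell-1,m,1,0}=\sqrt{\tfrac{(\ell+m)(\ell-m)}{\ell(2\ell-1)}}, && C^{\ell,m}_{\ell+1,m,1,0}=-\sqrt{\tfrac{(\ell-m+1)(\ell+m+1)}{(2\ell+3)(\ell+1)}},\\ &C^{\ell,m}_{\ell-1,m+1,1,-1}=\sqrt{\tfrac{(\ell-m)(\ell-m-1)}{(2\ell)(2\ell-1)}}, && C^{\ell,m}_{\ell+1,m+1,1,-1}=\sqrt{\tfrac{(\ell+m+1)(\ell+m+2)}{(2\ell+3)(2\ell+2)}},\\ &C^{\ell,m}_{\ell,m-1,1,1}=-\sqrt{\tfrac{(\ell+m)(\ell-m+1)}{\ell(2\ell+2)}}, && C^{\ell,m}_{\ell,m+1,1,-1}=\sqrt{\tfrac{(\ell+m+1)(\ell-m)}{\ell(2\ell+2)}},\qquad C^{\ell,m}_{\ell,m,1,0}=\tfrac{m}{\sqrt{\ell(\ell+1)}}. \end{aligned}$$ Let $c_\ell=\sqrt{\frac{\ell+1}{2\ell+1}}$ and $d_\ell=\sqrt{\frac{\ell}{2\ell+1}}$. Vector spherical harmonics. For $\ell\ge1$, $-\ell\le m\le\ell$, let $$\begin{aligned} B_{+1,\ell,m}&=c_\ell C^{\ell,m}_{\ell-1,m-1,1,1}Y_{\ell-1,m-1}+d_\ell C^{\ell,m}_{\ell+1,m-1,1,1}Y_{\ell+1,m-1},\\ B_{0,\ell,m}&=c_\ell C^{\ell,m}_{\ell-1,m,1,0}Y_{\ell-1,m}+d_\ell C^{\ell,m}_{\ell+1,m,1,0}Y_{\ell+1,m},\\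 B_{-1,\ell,m}&=c_\ell C^{\ell,m}_{\ell-1,m+1,1,-1}Y_{\ell-1,m+1}+d_\ell C^{\ell,m}_{\ell+1,m+1,1,-1}Y_{\ell+1,m+1},\\ D_{+1,\ell,m}&=\mathrm{i}\,C^{\ell,m}_{\ell,m-1,1,1}Y_{\ell,m-1},\quad D_{0,\ell,m}=\mathrm{i}\,C^{\ell,m}_{\ell,m,1,0}Y_{\ell,m},\quad D_{-1,\ell,m}=\mathrm{i}\,C^{\ell,m}_{\ell,m+1,1,-1}Y_{\ell,m+1}. \end{aligned}$$ The (so-called divergence-free and curl-free) vector spherical harmonics are the column-vector-valued functions $\mathbb{S}^2\to\mathbb{C}^3$ $$\mathbf{y}_{\ell,m}=\begin{pmatrix} -\frac1{\sqrt2}(B_{+1,\ell,m}-B_{-1,\ell,m}) \\ -\frac1{\sqrt2}\mathrm{i}(B_{+1,\ell,m}+B_{-1,\ell,m}) \\ {B_{0,\ell,m}} \end{pmatrix},\qquad \mathbf{z}_{\ell,m}=\begin{pmatrix} -\frac1{\sqrt2}(D_{+1,\ell,m}-D_{-1,\ell,m}) \\ -\frac1{\sqrt2}\mathrm{i}(D_{+1,\ell,m}+D_{-1,\ell,m}) \\ {D_{0,\ell,m}} \end{pmatrix}.$$ Adjoint scalar spherical harmonic transform. For $K\ge0$ and complex numbers $g_{\ell,m}$ ($0\le\ell\le K$, $-\ell\le m\le\ell$), $S_K(g_{\ell,m})=\sum_{\ell=0}^{K}\sum_{m=-\ell}^{\ell}g_{\ell,m}Y_{\ell,m}$. Coefficients.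 For $\ell=0,\dots,L-1$ and $m=-\ell,\dots,\ell$: $\nu^{(1)}_{\ell,m}=c_{\ell+1}\bigl(a_{\ell+1,m+1}C^{\ell+1,m+1}_{\ell,m,1,1}-a_{\ell+1,m-1}C^{\ell+1,m-1}_{\ell,m,1,-1}\bigr)$, $\nu^{(3)}_{\ell,m}=\mathrm{i}\,c_{\ell+1}\bigl(a_{\ell+1,m+1}C^{\ell+1,m+1}_{\ell,m,1,1}+a_{\ell+1,m-1}C^{\ell+1,m-1}_{\ell,m,1,-1}\bigr)$, $\nu^{(5)}_{\ell,m}=a_{\ell+1,m}c_{\ell+1}C^{\ell+1,m}_{\ell,m,1,0}$. For $\ell=2,\dots,L+1$ and $|m|=0,1,\dots,\ell-2$: $\nu^{(2)}_{\ell,m}=d_{\ell-1}\bigl(a_{\ell-1,m+1}C^{\ell-1,m+1}_{\ell,m,1,1}-a_{\ell-1,m-1}C^{\ell-1,m-1}_{\ell,m,1,-1}\bigr)$, $\nu^{(4)}_{\ell,m}=\mathrm{i}\,d_{\ell-1}\bigl(a_{\ell-1,m+1}C^{\ell-1,m+1}_{\ell,m,1,1}+a_{\ell-1,m-1}C^{\ell-1,m-1}_{\ell,m,1,-1}\bigr)$; and $\nu^{(2)}_{\ell,m}=\nu^{(4)}_{\ell,m}=0$ if $\ell=0,1$ or $|m|=\ell-1,\ell$. For $\ell=2,\dots,L+1$ and $|m|=0,1,\dots,\ell-1$: $\nu^{(6)}_{\ell,m}=a_{\ell-1,m}d_{\ell-1}C^{\ell-1,m}_{\ell,m,1,0}$;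 and $\nu^{(6)}_{\ell,m}=0$ if $\ell=0,1$ or $|m|=\ell$. For $\ell=1,\dots,L$ and $m=-\ell,\dots,\ell$ (any term containing $b_{\ell,m'}$ with $|m'|>\ell$ being $0$): $\eta^{(1)}_{\ell,m}=\mathrm{i}\bigl(b_{\ell,m+1}C^{\ell,m+1}_{\ell,m,1,1}-b_{\ell,m-1}C^{\ell,m-1}_{\ell,m,1,-1}\bigr)$, $\eta^{(2)}_{\ell,m}=b_{\ell,m+1}C^{\ell,m+1}_{\ell,m,1,1}+b_{\ell,m-1}C^{\ell,m-1}_{\ell,m,1,-1}$, $\eta^{(3)}_{\ell,m}=\mathrm{i}\,b_{\ell,m}C^{\ell,m}_{\ell,m,1,0}$; and $\eta^{(1)}_{0,0}=\eta^{(2)}_{0,0}=\eta^{(3)}_{0,0}=0$.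
   Formalization: For ℓ≥2 and |m|=ℓ−1 or ℓ, ν^(2) and ν^(4) are not set to 0 (the identity then fails, e.g. L=1 with only a_{1,−1}=1): they are given by the same formula as for |m|≤ℓ−2, any term containing a_{ℓ−1,m'} with |m'|>ℓ−1 being 0. *)

(* Defs.v *)
From HB Require Import structures.
From mathcomp Require Import all_boot all_order all_algebra.
From mathcomp Require Import all_classical all_reals all_analysis.
From mathcomp Require Import complex.

Set Implicit Arguments.
Unset Strict Implicit.
Unset Printing Implicit Defensive.

Import Order.TTheory GRing.Theory Num.Theory.

Local Open Scope ring_scope.
Local Open Scope complex_scope.

Definition col3 (T : Type) (u v w : T) : 'cV[T]_3 :=
  \col_(i < 3) (if i == 0 then u else if i == 1 then v else w).

Definition sphere2 (R : realType) : set 'cV[R]_3 :=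
  [set x | \sum_(i < 3) x i 0 ^+ 2 = 1].

Definition spherical (R : realType) (theta phi : R) : 'cV[R]_3 :=
  col3 (sin theta * cos phi) (sin theta * sin phi) (cos theta).

Definition colatitude (R : realType) (x : 'cV[R]_3) : R := acos (x 2 0).

(* At the poles this is [acos (0 / 0) = acos 0 = pi / 2]; the choice does not
   matter, see [sphY_spherical]. *)
Definition azimuth (R : realType) (x : 'cV[R]_3) : R :=
  let t := acos (x 0 0 / Num.sqrt (x 0 0 ^+ 2 + x 1 0 ^+ 2)) in
  if 0 <= x 1 0 then t else - t.

Definition expi (R : realType) (t : R) : R[i] := cos t +i* sin t.

Definition legendreP (R : realType) (l m : nat) (t : R) : R :=
  (-1) ^+ m / (2 ^+ l * l`!%:R) * (1 - t ^+ 2) `^ (m%:R / 2)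
  * derive1n (l + m) (fun u : R => (u ^+ 2 - 1) ^+ l) t.

(* [Y_{l,m}] for [0 <= m <= l], in spherical coordinates. *)
Definition angY_nneg (R : realType) (l m : nat) (theta phi : R) : R[i] :=
  (Num.sqrt ((2 * l + 1)%:R / (4 * pi) * ((l - m)`!%:R / (l + m)`!%:R))
   * legendreP l m (cos theta))%:C * expi (m%:R * phi).

Definition angY (R : realType) (l : nat) (m : int) (theta phi : R) : R[i] :=
  if (`|m| <= l)%N then
    if 0 <= m then angY_nneg l `|m|%N theta phi
    else (-1) ^+ `|m|%N * (angY_nneg l `|m|%N theta phi)^*
  else 0.

Definition sphY (R : realType) (l : nat) (m : int) (x : 'cV[R]_3) : R[i] :=
  angY l m (colatitude x) (azimuth x).

Lemma sphere2E (R : realType) (x : 'cV[R]_3) :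
  sphere2 x -> x 0 0 ^+ 2 + x 1 0 ^+ 2 + x 2 0 ^+ 2 = 1.
Proof.
rewrite /sphere2 /= !big_ord_recl big_ord0 addr0 addrA => <-.
by congr (_ ^+ 2 + _ ^+ 2 + _ ^+ 2); congr (x _ _); apply/val_inj.
Qed.

Lemma azimuthP (R : realType) (x : 'cV[R]_3)
    (r := Num.sqrt (x 0 0 ^+ 2 + x 1 0 ^+ 2)) :
  r * cos (azimuth x) = x 0 0 /\ r * sin (azimuth x) = x 1 0.
Proof.
have u2 := sqr_ge0 (x 0 0); have v2 := sqr_ge0 (x 1 0).
have uv : 0 <= x 0 0 ^+ 2 + x 1 0 ^+ 2 by rewrite addr_ge0.
have rE : r ^+ 2 = x 0 0 ^+ 2 + x 1 0 ^+ 2 by rewrite sqr_sqrtr.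
have r0 : 0 <= r by rewrite sqrtr_ge0.
have [rz|rn0] := eqVneq r 0.
  move: rE; rewrite rz expr0n/= => /esym/eqP.
  by rewrite paddr_eq0// !sqrf_eq0 => /andP[/eqP -> /eqP ->]; rewrite !mul0r.
have rgt : 0 < r by rewrite lt_neqAle eq_sym rn0.
set q := x 0 0 / r.
have q1 : -1 <= q <= 1.
  rewrite -ler_norml -(ler_sqr) ?nnegrE// real_normK ?num_real// expr1n.
  by rewrite expr_div_n ler_pdivrMr ?exprn_gt0// mul1r rE lerDl.
have sE : r * Num.sqrt (1 - q ^+ 2) = `|x 1 0|.
  rewrite -{1}(ger0_norm r0) -sqrtr_sqr -sqrtrM ?sqr_ge0// -sqrtr_sqr.
  congr Num.sqrt.
  by rewrite mulrBr mulr1 expr_div_n mulrC divfK ?expf_neq0// rE addrAC subrr add0r.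
have cE : r * cos (acos q) = x 0 0.
  by rewrite acosK ?in_itv// mulrC divfK.
rewrite /azimuth -/r -/q; case: ifPn => y0.
  by split => //; rewrite sin_acos// sE ger0_norm.
rewrite cosN sinN; split => //.
by rewrite sin_acos// mulrN sE ltr0_norm ?opprK// ltNge.
Qed.

Lemma spherical_coordK (R : realType) (x : 'cV[R]_3) : sphere2 x ->
  spherical (colatitude x) (azimuth x) = x.
Proof.
move=> /sphere2E x1; have [cE sE] := azimuthP x.
have z1 : -1 <= x 2 0 <= 1.
  rewrite -ler_norml -(ler_sqr) ?nnegrE// real_normK ?num_real// expr1n.
  by rewrite -x1 lerDr addr_ge0// sqr_ge0.
have zE : sin (colatitude x) = Num.sqrt (x 0 0 ^+ 2 + x 1 0 ^+ 2).
  by rewrite sin_acos// -x1 addrK.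
apply/colP => i; rewrite mxE zE cE sE.
case: i => [[|[|[|//]]] i3] /=; [congr (x _ _)|congr (x _ _)|]; try exact/val_inj.
by rewrite acosK ?in_itv//; congr (x _ _); exact/val_inj.
Qed.

Lemma expi_natM (R : realType) (n : nat) (t : R) :
  expi (n%:R * t) = expi t ^+ n.
Proof.
elim: n => [|n IHn]; first by rewrite mul0r /expi cos0 sin0.
rewrite exprS -IHn -natr1 mulrDl mul1r addrC /expi cosD sinD.
apply/eqP; rewrite eq_complex/= [X in _ && (X == _)]addrC.
by rewrite [sin _ * cos _]mulrC eqxx /= addrC.
Qed.

Lemma angY_nneg_spherical (R : realType) (l m : nat) (theta phi : R)
    (x := spherical theta phi) : 0 <= theta <= pi ->
  angY_nneg l m (colatitude x) (azimuth x) = angY_nneg l m theta phi.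
Proof.
move=> th; have cE : colatitude x = theta.
  by rewrite /colatitude mxE/= cosK ?in_itv.
rewrite /angY_nneg cE !expi_natM.
have s0 : 0 <= sin theta by rewrite sin_ge0_pi.
have rE : Num.sqrt (x 0 0 ^+ 2 + x 1 0 ^+ 2) = sin theta.
  by rewrite !mxE/= !exprMn -mulrDr cos2Dsin2 mulr1 sqrtr_sqr ger0_norm.
have [] := azimuthP x; rewrite rE !mxE /=.
have [s1|s1] := eqVneq (sin theta) 0.
  move=> _ _; case: m => [|m]; first by rewrite !expr0.
  have -> : legendreP l m.+1 (cos theta) = 0.
    have p0 : m.+1%:R / 2 != 0 :> R by rewrite mulf_neq0// ?invr_eq0 pnatr_eq0.
    by rewrite /legendreP -sin2cos2 s1 expr0n/= powR0// mulr0 mul0r.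
  by rewrite mulr0 !mul0r.
by move=> /(mulfI s1) c /(mulfI s1) s; rewrite /expi c s.
Qed.

Lemma sphY_spherical (R : realType) (l : nat) (m : int) (theta phi : R) :
  0 <= theta <= pi -> sphY l m (spherical theta phi) = angY l m theta phi.
Proof. by move=> th; rewrite /sphY /angY !angY_nneg_spherical. Qed.

(* The Clebsch-Gordan coefficient [C^{l,m}_{j,m1,1,m2}] for [1 <= l]; the
   values that are not listed vanish by the selection rules [m1 + m2 = m],
   [`|m| <= l], [`|m2| <= 1] and [`|j - l| <= 1]. *)
Definition CG1 (R : realType) (l : nat) (m : int) (j : nat) (m1 m2 : int) : R :=
  let lr : R := l%:R in
  let mr : R := m%:~R in
  if (m1 + m2 != m) || (l < `|m|)%N then 0
  else if j.+1 == l then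
    if m2 == 1 then
      Num.sqrt ((lr + mr) * (lr + mr - 1) / ((2 * lr) * (2 * lr - 1)))
    else if m2 == 0 then
      Num.sqrt ((lr + mr) * (lr - mr) / (lr * (2 * lr - 1)))
    else if m2 == -1 then
      Num.sqrt ((lr - mr) * (lr - mr - 1) / ((2 * lr) * (2 * lr - 1)))
    else 0
  else if j == l then
    if m2 == 1 then
      - Num.sqrt ((lr + mr) * (lr - mr + 1) / (lr * (2 * lr + 2)))
    else if m2 == 0 then
      mr / Num.sqrt (lr * (lr + 1))
    else if m2 == -1 then
      Num.sqrt ((lr + mr + 1) * (lr - mr) / (lr * (2 * lr + 2)))
    else 0
  else if j == l.+1 then
    if m2 == 1 then
      Num.sqrt ((lr - mr + 1) * (lr - mr + 2) / ((2 * lr + 2) * (2 * lr + 3)))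
    else if m2 == 0 then
      - Num.sqrt ((lr - mr + 1) * (lr + mr + 1) / ((2 * lr + 3) * (lr + 1)))
    else if m2 == -1 then
      Num.sqrt ((lr + mr + 1) * (lr + mr + 2) / ((2 * lr + 3) * (2 * lr + 2)))
    else 0
  else 0.

Definition coef_c (R : realType) (l : nat) : R :=
  Num.sqrt ((l%:R + 1) / (2 * l%:R + 1)).

Definition coef_d (R : realType) (l : nat) : R :=
  Num.sqrt (l%:R / (2 * l%:R + 1)).

(* [B_{s,l,m}] and [D_{s,l,m}] for [s] in [{1, 0, -1}]. *)
Definition vshB (R : realType) (s : int) (l : nat) (m : int) (x : 'cV[R]_3)
    : R[i] :=
  (coef_c R l * CG1 R l m l.-1 (m - s) s)%:C * sphY l.-1 (m - s) x
  + (coef_d R l * CG1 R l m l.+1 (m - s) s)%:C * sphY l.+1 (m - s) x.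

Definition vshD (R : realType) (s : int) (l : nat) (m : int) (x : 'cV[R]_3)
    : R[i] :=
  'i * (CG1 R l m l (m - s) s)%:C * sphY l (m - s) x.

Definition isqrt2 (R : realType) : R[i] := (1 / Num.sqrt (2 : R))%:C.

Definition vshy (R : realType) (l : nat) (m : int) (x : 'cV[R]_3)
    : 'cV[R[i]]_3 :=
  col3 (- isqrt2 R * (vshB 1 l m x - vshB (-1) l m x))
       (- isqrt2 R * 'i * (vshB 1 l m x + vshB (-1) l m x))
       (vshB 0 l m x).

Definition vshz (R : realType) (l : nat) (m : int) (x : 'cV[R]_3)
    : 'cV[R[i]]_3 :=
  col3 (- isqrt2 R * (vshD 1 l m x - vshD (-1) l m x))
       (- isqrt2 R * 'i * (vshD 1 l m x + vshD (-1) l m x))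
       (vshD 0 l m x).

(* [\sum_{m = -l}^{l} F m] *)
Definition sum_order (V : nmodType) (l : nat) (F : int -> V) : V :=
  \sum_(k < (2 * l).+1) F (k%:Z - l%:Z).

Definition adjSHT (R : realType) (K : nat) (g : nat -> int -> R[i])
    (x : 'cV[R]_3) : R[i] :=
  \sum_(0 <= l < K.+1) sum_order l (fun m => g l m * sphY l m x).

Definition adjVSHT (R : realType) (L : nat) (a b : nat -> int -> R[i])
    (x : 'cV[R]_3) : 'cV[R[i]]_3 :=
  \sum_(1 <= l < L.+1)
    sum_order l (fun m => a l m *: vshy l m x + b l m *: vshz l m x).

(* Coefficient sequences are only meaningful for [1 <= l] and [`|m| <= l]; they
   are represented by total functions, and [in_order a] reads a coefficient with
   the convention that it is [0] when [`|m| > l]. *)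
Definition in_order (R : realType) (a : nat -> int -> R[i]) (l : nat) (m : int)
    : R[i] :=
  if (`|m| <= l)%N then a l m else 0.

Section Coefficients.
Variables (R : realType) (a b : nat -> int -> R[i]).

Definition nu1 (l : nat) (m : int) : R[i] :=
  (coef_c R l.+1)%:C
  * (a l.+1 (m + 1) * (CG1 R l.+1 (m + 1) l m 1)%:C
     - a l.+1 (m - 1) * (CG1 R l.+1 (m - 1) l m (-1))%:C).

Definition nu3 (l : nat) (m : int) : R[i] :=
  'i * (coef_c R l.+1)%:C
  * (a l.+1 (m + 1) * (CG1 R l.+1 (m + 1) l m 1)%:C
     + a l.+1 (m - 1) * (CG1 R l.+1 (m - 1) l m (-1))%:C).

Definition nu5 (l : nat) (m : int) : R[i] :=
  a l.+1 m * (coef_c R l.+1)%:C * (CG1 R l.+1 m l m 0)%:C.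

(* For [`|m| <= l - 2] both coefficients of order [l - 1] are in range.  For
   [`|m| = l - 1] or [l] exactly one of them is, and its term is kept:
   [Y_{l,m}] does occur in [y_{l-1,m-1}] for [m = l - 1, l] and in
   [y_{l-1,m+1}] for [m = 1 - l, - l], so setting [nu2] and [nu4] to [0] there
   would make the representation false (already for [L = 1] with [a 1 (-1) = 1]
   the only nonzero coefficient). *)
Definition nu2 (l : nat) (m : int) : R[i] :=
  if (2 <= l)%N then
    (coef_d R l.-1)%:C
    * (in_order a l.-1 (m + 1) * (CG1 R l.-1 (m + 1) l m 1)%:C
       - in_order a l.-1 (m - 1) * (CG1 R l.-1 (m - 1) l m (-1))%:C)
  else 0.

Definition nu4 (l : nat) (m : int) : R[i] :=
  if (2 <= l)%N then
    'i * (coef_d R l.-1)%:C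
    * (in_order a l.-1 (m + 1) * (CG1 R l.-1 (m + 1) l m 1)%:C
       + in_order a l.-1 (m - 1) * (CG1 R l.-1 (m - 1) l m (-1))%:C)
  else 0.

Definition nu6 (l : nat) (m : int) : R[i] :=
  if (2 <= l)%N && (`|m| <= l.-1)%N then
    a l.-1 m * (coef_d R l.-1)%:C * (CG1 R l.-1 m l m 0)%:C
  else 0.

Definition eta1 (l : nat) (m : int) : R[i] :=
  if (1 <= l)%N then
    'i * (in_order b l (m + 1) * (CG1 R l (m + 1) l m 1)%:C
          - in_order b l (m - 1) * (CG1 R l (m - 1) l m (-1))%:C)
  else 0.

Definition eta2 (l : nat) (m : int) : R[i] :=
  if (1 <= l)%N then
    in_order b l (m + 1) * (CG1 R l (m + 1) l m 1)%:C
    + in_order b l (m - 1) * (CG1 R l (m - 1) l m (-1))%:C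
  else 0.

Definition eta3 (l : nat) (m : int) : R[i] :=
  if (1 <= l)%N then 'i * b l m * (CG1 R l m l m 0)%:C else 0.

End Coefficients.

(* Main.v *)
Require Import Defs.
From mathcomp Require Import all_boot all_order all_algebra.
From mathcomp Require Import all_classical all_reals all_analysis.
From mathcomp Require Import complex.
From mathcomp Require Import ring zify.

Set Implicit Arguments.
Unset Strict Implicit.
Unset Printing Implicit Defensive.

Import Order.TTheory GRing.Theory Num.Theory.

Local Open Scope ring_scope.
Local Open Scope complex_scope.

(** The representation is a change of summation index.  A component of
    [y_{l,m}] or [z_{l,m}] is a combination, with constants that do not depend
    on [l] and [m], of the three functions [B_{s,l,m}], or [D_{s,l,m}], with
    [s] in [{1, 0, -1}].  Each of these is a combination of [Y_{j,m-s}] with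
    [j = l - 1] and [j = l + 1], or with [j = l].  Collecting the factor of
    each [Y_{j,n}] means substituting [n = m - s] in the sum over the order and
    [j = l - 1], [j = l + 1] or [j = l] in the sum over the degree.

    The only question is whether the ranges of summation match after the
    substitution.  They do up to vanishing terms.  On the source side, a pair
    with [`|m| <= l] but [`|m - s| > j] contributes nothing since
    [Y_{j,m-s} = 0].  On the target side, a pair with [`|n| <= j] but
    [`|n + s| > l] contributes nothing: for [j = l + 1] and [j = l] the
    coefficient of [Y_{j,n}] is [0] by the convention on orders out of range,
    and for [j = l - 1] there is no such pair because [`|s| <= 1].

    To avoid bookkeeping on interval bounds, a sum over [- l <= m <= l] is
    turned into a sum over all integers of a family cut off outside that range
    ([sum_order_fsbig]); there the translation [m |-> m - s] is a bijection
    ([sum_order_shift]).  The lemmas [degree_sum_vshB] and [degree_sum_vshD]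
    apply this to the functions [B] and [D], and the theorem follows from them
    by linearity. *)

(** * Sums over the order *)

Definition cutoff (V : nmodType) (l : nat) (F : int -> V) (m : int) : V :=
  if (`|m| <= l)%N then F m else 0.

(** Summing over all of [int] makes translations of the index available
    without any condition on the bounds. *)
Lemma sum_order_fsbig (V : nmodType) (l : nat) (F : int -> V) :
  sum_order l F = \sum_(m \in [set: int]) cutoff l F m.
Proof.
pose s : seq int := [seq k%:Z - l%:Z | k <- iota 0 (2 * l).+1].
have us : uniq s by rewrite map_inj_uniq ?iota_uniq// => i j; lia.
have sE m : (m \in s) = (`|m| <= l)%N.
  apply/mapP/idP => [[k]|ml]; first by rewrite mem_iota => kl ->; lia.
  by exists (absz (m + l%:Z)); rewrite ?mem_iota; lia.
rewrite (fsbigE s)//; last by move=> m _; rewrite sE /cutoff => /negPf ->.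
rewrite big_mkcond/= big_seq (eq_bigr F) => [|m]; last first.
  by rewrite sE /cutoff in_setT => ->.
rewrite -big_seq big_map /sum_order.
by rewrite -(big_mkord xpredT (fun k => F (k%:Z - l%:Z))) /index_iota subn0.
Qed.

(** Only the families cut off to their ranges have to correspond, so the two
    ranges may differ where the summands vanish. *)
Lemma sum_order_shift (V : nmodType) (l k : nat) (s : int) (F G : int -> V) :
    (forall m, cutoff l F m = cutoff k G (m - s)) ->
  sum_order l F = sum_order k G.
Proof.
move=> FG; rewrite !sum_order_fsbig.
rewrite [RHS](reindex_fsbigT (fun m : int => m - s))/=; last first.
  by exists (fun m => m + s) => m; rewrite ?subrK ?addrK.
by apply: eq_fsbigr => m _; exact: FG.
Qed.

Lemma sum_order0 (V : nmodType) (l : nat) (F : int -> V) :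
  (forall m, F m = 0) -> sum_order l F = 0.
Proof. by move=> F0; rewrite /sum_order big1. Qed.

(** * Linearity *)

Definition degree_sum (V : nmodType) (L : nat) (F : nat -> int -> V) : V :=
  \sum_(1 <= l < L.+1) sum_order l (F l).

Lemma eq_degree_sum (V : nmodType) (L : nat) (F G : nat -> int -> V) :
  (forall l m, F l m = G l m) -> degree_sum L F = degree_sum L G.
Proof.
by move=> FG; apply: eq_bigr => l _; apply: eq_bigr => k _; rewrite FG.
Qed.

Lemma degree_sumD (V : nmodType) (L : nat) (F G : nat -> int -> V) :
  degree_sum L (fun l m => F l m + G l m) = degree_sum L F + degree_sum L G.
Proof.
by rewrite /degree_sum -big_split; apply: eq_bigr => l _; exact: big_split.
Qed.

Lemma degree_sumM (A : pzSemiRingType) (L : nat) (u : A)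
    (F : nat -> int -> A) :
  degree_sum L (fun l m => u * F l m) = u * degree_sum L F.
Proof.
by rewrite /degree_sum mulr_sumr; apply: eq_bigr => l _; rewrite mulr_sumr.
Qed.

Lemma adjVSHT_coord (R : realType) (L : nat) (a b : nat -> int -> R[i])
    (x : 'cV[R]_3) (i : 'I_3) :
  adjVSHT L a b x i 0
  = degree_sum L (fun l m => a l m * vshy l m x i 0 + b l m * vshz l m x i 0).
Proof.
rewrite /adjVSHT summxE; apply: eq_bigr => l _.
by rewrite summxE; apply: eq_bigr => k _; rewrite !mxE.
Qed.

Lemma adjSHT_lin (R : realType) (K : nat) (g g1 g2 : nat -> int -> R[i])
    (u v : R[i]) (x : 'cV[R]_3) :
    (forall l m, g l m = u * g1 l m + v * g2 l m) ->
  adjSHT K g x = u * adjSHT K g1 x + v * adjSHT K g2 x.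
Proof.
move=> gE; rewrite /adjSHT !mulr_sumr -big_split; apply: eq_bigr => l _.
rewrite /sum_order !mulr_sumr -big_split; apply: eq_bigr => k _.
by rewrite gE mulrDl !mulrA.
Qed.

Lemma adjSHTN (R : realType) (K : nat) (g : nat -> int -> R[i])
    (x : 'cV[R]_3) :
  adjSHT K (fun l m => - g l m) x = - adjSHT K g x.
Proof.
rewrite /adjSHT -sumrN; apply: eq_bigr => l _.
by rewrite /sum_order -sumrN; apply: eq_bigr => k _; rewrite mulNr.
Qed.

(** * The functions [B] and [D] in terms of scalar harmonics *)

Lemma sphY_out (R : realType) (l : nat) (m : int) (x : 'cV[R]_3) :
  (l < `|m|)%N -> sphY l m x = 0.
Proof. by rewrite ltnNge /sphY /angY => /negPf ->. Qed.

(** The coefficient of [Y_{l,m}] in the sum of the [a_{j,n} B_{s,j,n}] is made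
    of this part, from [j = l + 1], and of [upper_coef], from [j = l - 1]; the
    names refer to the degree of the scalar harmonic relative to [j]. *)
Definition lower_coef (R : realType) (s : int) (a : nat -> int -> R[i])
    (l : nat) (m : int) : R[i] :=
  a l.+1 (m + s) * (coef_c R l.+1 * CG1 R l.+1 (m + s) l m s)%:C.

Definition upper_coef (R : realType) (s : int) (a : nat -> int -> R[i])
    (l : nat) (m : int) : R[i] :=
  if (2 <= l)%N then
    in_order a l.-1 (m + s) * (coef_d R l.-1 * CG1 R l.-1 (m + s) l m s)%:C
  else 0.

Definition same_coef (R : realType) (s : int) (b : nat -> int -> R[i])
    (l : nat) (m : int) : R[i] :=
  if (1 <= l)%N then
    'i * (in_order b l (m + s) * (CG1 R l (m + s) l m s)%:C)
  else 0.

Section Shift.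
Variables (R : realType) (L : nat) (s : int) (a : nat -> int -> R[i]).
Variable x : 'cV[R]_3.
Hypothesis s1 : (`|s| <= 1)%N.

(** The degrees [1, ..., L] become [0, ..., L - 1].  Every order [n] of
    the new range comes from an order of the old one: [`|n| <= l - 1] and
    [`|s| <= 1] give [`|n + s| <= l]. *)
Lemma degree_sum_lower : (0 < L)%N ->
  degree_sum L (fun l m => a l m *
    ((coef_c R l * CG1 R l m l.-1 (m - s) s)%:C * sphY l.-1 (m - s) x))
  = adjSHT L.-1 (lower_coef s a) x.
Proof.
move=> L0; rewrite /degree_sum /adjSHT big_add1 /= prednK//.
apply: eq_bigr => l _; apply: (@sum_order_shift _ _ _ s) => m.
rewrite /cutoff /lower_coef /= subrK mulrA.
case: ifPn => ml; case: ifPn => msl //; last by exfalso; lia.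
by rewrite sphY_out ?mulr0// ltnNge.
Qed.

(** The degrees [1, ..., L] become [2, ..., L + 1]; the terms of degree [0]
    and [1] of the transform vanish. *)
Lemma degree_sum_upper :
  degree_sum L (fun l m => a l m *
    ((coef_d R l * CG1 R l m l.+1 (m - s) s)%:C * sphY l.+1 (m - s) x))
  = adjSHT L.+1 (upper_coef s a) x.
Proof.
rewrite /degree_sum /adjSHT [RHS]big_ltn// [X in _ + X]big_add1 /=.
rewrite [X in _ + X]big_ltn//.
rewrite !sum_order0 ?add0r; try by move=> m; rewrite /upper_coef mul0r.
apply: eq_big_nat => l /andP[l0 _].
apply: (@sum_order_shift _ _ _ s) => m.
rewrite /cutoff /upper_coef /in_order /= ltnS l0 subrK mulrA.
case: ifPn => ml; case: ifPn => msl //; try by rewrite !mul0r.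
by exfalso; lia.
Qed.

Lemma degree_sum_vshB : (0 < L)%N ->
  degree_sum L (fun l m => a l m * vshB s l m x)
  = adjSHT L.-1 (lower_coef s a) x + adjSHT L.+1 (upper_coef s a) x.
Proof.
move=> L0; rewrite -degree_sum_lower// -degree_sum_upper -degree_sumD.
by apply: eq_degree_sum => l m; rewrite -mulrDr.
Qed.

Lemma degree_sum_vshD :
  degree_sum L (fun l m => a l m * vshD s l m x) = adjSHT L (same_coef s a) x.
Proof.
rewrite /degree_sum /adjSHT [RHS]big_ltn//.
rewrite [X in X + _]sum_order0 ?add0r => [|m]; last by rewrite /same_coef mul0r.
apply: eq_big_nat => l /andP[l0 _].
apply: (@sum_order_shift _ _ _ s) => m.
rewrite /cutoff /same_coef /in_order /vshD l0 subrK.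
case: ifPn => ml; case: ifPn => msl //; last by rewrite mul0r mulr0 mul0r.
  by rewrite !mulrA; congr (_ * _ * _); rewrite mulrC.
by rewrite sphY_out ?mulr0// ltnNge.
Qed.

End Shift.

(** * The representation *)

(** The reduction common to the three coordinates: the scalars [k], [u] and
    [v] are those with which [B_s] and [B_t], or [D_s] and [D_t], enter the
    coordinate [i] of the vector spherical harmonics. *)
Lemma adjVSHT_coordE (R : realType) (L : nat) (a b : nat -> int -> R[i])
    (x : 'cV[R]_3) (i : 'I_3) (s t : int) (k u v : R[i])
    (g1 g2 g3 : nat -> int -> R[i]) :
    (0 < L)%N -> (`|s| <= 1)%N -> (`|t| <= 1)%N ->
    (forall l m, vshy l m x i 0 = k * (u * vshB s l m x + v * vshB t l m x)) ->
    (forall l m, vshz l m x i 0 = k * (u * vshD s l m x + v * vshD t l m x)) ->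
    (forall l m, g1 l m = u * lower_coef s a l m + v * lower_coef t a l m) ->
    (forall l m, g2 l m = u * upper_coef s a l m + v * upper_coef t a l m) ->
    (forall l m, g3 l m = u * same_coef s b l m + v * same_coef t b l m) ->
  adjVSHT L a b x i 0
  = k * (adjSHT L.-1 g1 x + adjSHT L.+1 g2 x + adjSHT L g3 x).
Proof.
move=> L0 s1 t1 yE zE g1E g2E g3E.
rewrite adjVSHT_coord (adjSHT_lin _ _ g1E) (adjSHT_lin _ _ g2E).
rewrite (adjSHT_lin _ _ g3E).
have regroup (p p' q q' r r' : R[i]) :
    k * (u * p + v * p' + (u * q + v * q') + (u * r + v * r'))
    = k * (u * (p + q + r) + v * (p' + q' + r')) by ring.
rewrite regroup.
rewrite -!degree_sum_vshB// -!degree_sum_vshD// -!degree_sumD -!degree_sumM.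
rewrite -degree_sumD -degree_sumM; apply: eq_degree_sum => l m.
rewrite yE zE; move: (vshB _ _ _ _) (vshB _ _ _ _) (vshD _ _ _ _) (vshD _ _ _ _).
by move=> ys yt zs zt; ring.
Qed.

Theorem theorem4p4 (R : realType) (a b : nat -> int -> R[i]) (L : nat)
    (hL : (1 <= L)%N) (x : 'cV[R]_3) (hx : sphere2 x) :
  adjVSHT L a b x =
  col3 (- isqrt2 R * (adjSHT L.-1 (nu1 a) x + adjSHT L.+1 (nu2 a) x
                      + adjSHT L (eta1 b) x))
       (- isqrt2 R * (adjSHT L.-1 (nu3 a) x + adjSHT L.+1 (nu4 a) x
                      - adjSHT L (eta2 b) x))
       (adjSHT L.-1 (nu5 a) x + adjSHT L.+1 (nu6 a) x + adjSHT L (eta3 b) x).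
Proof.
apply/colP => i; rewrite [RHS]mxE; case: i => [[|[|[|//]]] i3] /=.
- apply: (@adjVSHT_coordE _ _ _ _ _ _ 1 (-1) _ 1 (-1)) => // l m.
  + by rewrite mxE /= mul1r mulN1r.
  + by rewrite mxE /= mul1r mulN1r.
  + by rewrite /nu1 /lower_coef !rmorphM /=; ring.
  + by rewrite /nu2 /upper_coef !rmorphM /=; case: ifP => _; ring.
  + by rewrite /eta1 /same_coef; case: ifP => _; ring.
- rewrite -adjSHTN.
  apply: (@adjVSHT_coordE _ _ _ _ _ _ 1 (-1) _ 'i%R 'i%R) => // l m.
  + rewrite mxE /=; move: (vshB 1 l m x) (vshB (-1) l m x) => p q.
    by rewrite -mulrDr mulrA.
  + rewrite mxE /=; move: (vshD 1 l m x) (vshD (-1) l m x) => p q.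
    by rewrite -mulrDr mulrA.
  + by rewrite /nu3 /lower_coef !rmorphM /=; ring.
  + rewrite /nu4 /upper_coef !rmorphM /=.
    by case: ifP => _; ring.
  + rewrite /eta2 /same_coef; case: ifP => _.
      by rewrite -!mulrDr mulrA -expr2 sqrCi mulN1r.
    by rewrite !mulr0 addr0 oppr0.
- rewrite -[RHS]mul1r.
  apply: (@adjVSHT_coordE _ _ _ _ _ _ 0 0 _ 1 0) => // l m.
  + by rewrite mxE /= !mul1r mul0r addr0.
  + by rewrite mxE /= !mul1r mul0r addr0.
  + by rewrite /nu5 /lower_coef addr0 mul1r mul0r addr0 rmorphM mulrA.
  + rewrite /nu6 /upper_coef /in_order addr0 mul1r mul0r addr0.
    case: (1 < l)%N => //=; case: (`|m| <= l.-1)%N; last by rewrite mul0r.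
    by rewrite rmorphM mulrA.
  + rewrite /eta3 /same_coef /in_order addr0 mul1r mul0r addr0.
    case: ifP => // _; case: ifPn => [_|]; first by rewrite mulrA.
    (* out of range, [eta3] vanishes through its Clebsch-Gordan coefficient *)
    by rewrite -ltnNge /CG1 => ->; rewrite orbT !(mulr0, mul0r).
Qed.
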